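(* Let $d\ge 2$ and let $X$ be a random vector in $\mathbb{R}^d$ with distribution $F$. Let $X_1,X_2,\dots$ be i.i.d. with distribution $F$, and put $\mathcal{X}^n=\{X_1,\dots,X_n\}$. Suppose that (C1) the sample $\mathcal{X}^n$ is of affine dimension $d$ (almost surely, for all sufficiently large $n$); (C2) $F$ is halfspace symmetric about a point $\theta_0\in\mathbb{R}^d$; (C3) $F$ is smooth at $\theta_0$. Then the finite sample addition breakdown point of Tukey's halfspace median $T^*$ satisfies $$\varepsilon(T^*,\mathcal{X}^n)\longrightarrow \frac13\quad\text{almost surely, as } n\to\infty .$$
   Context: Samples are finite multisets (repetitions allowed). A sample in $\mathbb{R}^d$ is of affine dimension $d$ if its affine hull is $\mathbb{R}^d$. Let $\mathcal{S}^{d-1}=\{u\in\mathbb{R}^d:\|u\|=1\}$ with $\|\cdot\|$ the Euclidean norm. Halfspace depth: for a sample $\mathcal{X}^n$ of size $n$ with empirical distribution $F_n$ and empirical probability measure $P_n$, $D(x,F_n)=\inf_{u\in\mathcal{S}^{d-1}}P_n(u^\top X\le u^\top x)$. Tukey's halfspace median: $T^*(\mathcal{X}^n)$ is the average (centroid) of all points of the median region $\mathcal{M}(\mathcal{X}^n)=\{x\in\mathbb{R}^d: D(x,F_n)=\sup_{z\in\mathbb{R}^d}D(z,F_n)\}$. Finite sample addition breakdown point of a location estimator $T$ at a sample $\mathcal{X}^n$ of size $n$: $$\varepsilon(T,\mathcal{X}^n)=\min_{1\le m\le n}\left\{\frac{m}{n+m}:\ \sup_{\mathcal{Y}^m}\|T(\mathcal{X}^n\cup\mathcal{Y}^m)-T(\mathcal{X}^n)\|=\infty\right\},$$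 where $\mathcal{Y}^m$ ranges over all data sets of $m$ points in $\mathbb{R}^d$ with arbitrary values and $\mathcal{X}^n\cup\mathcal{Y}^m$ is the contaminated sample of size $n+m$ (multiset union). Halfspace symmetry: $X$ (or its distribution $F$) is halfspace symmetric about $\theta_0$ if $P(X\in\mathcal{H})\ge 1/2$ for every (closed) halfspace $\mathcal{H}$ containing $\theta_0$. Smoothness: $F$ is smooth at $x_0$ if $P(X\in\partial\mathcal{H})=0$ for every halfspace $\mathcal{H}$ with $x_0$ on its boundary $\partial\mathcal{H}$. *)

(* Defs.v *)
From HB Require Import structures.
From mathcomp Require Import all_boot all_order all_algebra finmap.
From mathcomp Require Import all_classical all_reals all_analysis.

Set Implicit Arguments.
Unset Strict Implicit.
Unset Printing Implicit Defensive.
Import Order.TTheory GRing.Theory Num.Theory.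
Import numFieldNormedType.Exports.
Local Open Scope classical_set_scope.
Local Open Scope ring_scope.

Section euclidean.
Context {R : realType} {d : nat}.
Implicit Types (u x z : 'rV[R]_d) (c : R) (A : set 'rV[R]_d).

Definition dot u x : R := (u *m x^T) 0 0.

(* The library norm `|x| on 'rV[R]_d is the sup norm. *)
Definition enorm x : R := Num.sqrt (dot x x).

Definition unit_sphere : set 'rV[R]_d := [set u | enorm u = 1].

(* Halfspaces and hyperplanes are genuine only for u != 0. *)
Definition closed_halfspace u c : set 'rV[R]_d := [set z | dot u z <= c].

Definition hyperplane u c : set 'rV[R]_d := [set z | dot u z = c].

Definition affine_hull A : set 'rV[R]_d :=
  [set x | exists (k : nat) (p : 'I_k -> 'rV[R]_d) (w : 'I_k -> R),
    [/\ forall i, A (p i), \sum_i w i = 1 & x = \sum_i w i *: p i]].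

End euclidean.

(* One induction step of the product Lebesgue measure on R^k: the product
   lebesgue_measure \x m seen on k.+1.-tuples. *)
Section lebesgue_cons.
Local Open Scope ereal_scope.
Context {R : realType} {k : nat}.
Variable m : {sigma_finite_measure set (k.-tuple (measurableTypeR R)) -> \bar R}.

Definition tuple_cons (p : measurableTypeR R * k.-tuple (measurableTypeR R)) :
  k.+1.-tuple (measurableTypeR R) := [tuple of p.1 :: p.2].

Lemma measurable_tuple_cons : measurable_fun [set: _] tuple_cons.
Proof. exact: measurable_cons. Qed.

HB.instance Definition _ := isMeasurableFun.Build _ _ _ _
  tuple_cons measurable_tuple_cons.

Definition lebesgue_cons : set (k.+1.-tuple (measurableTypeR R)) -> \bar R :=
  pushforward (@lebesgue_measure R \x m) tuple_cons.

Let lebesgue_cons0 : lebesgue_cons set0 = 0.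
Proof. exact: measure0. Qed.

Let lebesgue_cons_ge0 A : 0 <= lebesgue_cons A.
Proof. exact: measure_ge0. Qed.

Let lebesgue_cons_sigma_additive : semi_sigma_additive lebesgue_cons.
Proof. exact: measure_semi_sigma_additive. Qed.

HB.instance Definition _ := isMeasure.Build _ _ _ lebesgue_cons
  lebesgue_cons0 lebesgue_cons_ge0 lebesgue_cons_sigma_additive.

Let lebesgue_cons_sigma_finite : sigma_finite setT lebesgue_cons.
Proof.
pose g (t : k.+1.-tuple (measurableTypeR R)) :
  measurableTypeR R * k.-tuple (measurableTypeR R) :=
  (thead t, [tuple of behead t]).
have mg : measurable_fun setT g.
  apply: measurable_fun_pair; last exact: measurable_behead.
  exact: (@measurable_tnth _ _ _ ord0).
have fK : cancel tuple_cons g.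
  by case=> x t; rewrite /g theadE; congr pair; apply/val_inj.
have /sigma_finiteP[G [GT ndG Goo]] := sigma_finiteT (@lebesgue_measure R).
have /sigma_finiteP[H [HT ndH Hoo]] := sigma_finiteT m.
pose F n := G n `*` H n.
have FT : setT = \bigcup_n F n.
  rewrite -setXTT GT HT predeqE => -[x y]; split.
    move=> [/= [i _ Gix] [j _ Hjy]]; exists (maxn i j) => //; split.
    - by move: x Gix; exact/subsetPset/ndG/leq_maxl.
    - by move: y Hjy; exact/subsetPset/ndH/leq_maxr.
  by move=> [n _ []/= ? ?]; split; exists n.
have Foo n : measurable (F n) /\ (@lebesgue_measure R \x m) (F n) < +oo.
  have [? ?] := Goo n; have [? ?] := Hoo n; split; first exact: measurableX.
  by rewrite product_measure1E// lte_mul_pinfty// ge0_fin_numE.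
exists (fun n => g @^-1` F n).
  by rewrite -preimage_bigcup -FT preimage_setT.
move=> n; have [mFn Fnoo] := Foo n; split.
  by rewrite -[X in measurable X]setTI; exact: mg.
rewrite /lebesgue_cons /pushforward -comp_preimage.
by rewrite (_ : g \o tuple_cons = id) ?preimage_id//; apply/funext.
Qed.

HB.instance Definition _ := Measure_isSigmaFinite.Build _ _ _ lebesgue_cons
  lebesgue_cons_sigma_finite.

End lebesgue_cons.

Fixpoint lebesgue_tuple (R : realType) (k : nat) :
    {sigma_finite_measure set (k.-tuple (measurableTypeR R)) -> \bar R} :=
  match k with
  | 0 => \d_([tuple] : 0.-tuple (measurableTypeR R))
  | k'.+1 => lebesgue_cons (lebesgue_tuple R k')
  end.

Section centroid.
Context {R : realType} {d : nat}.
Implicit Types (K : set 'rV[R]_d) (c : 'rV[R]_d).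

Definition row_of_tuple (k : nat) (t : k.-tuple (measurableTypeR R)) :
  'rV[R]_k := \row_i tnth t i.

(* c is the average of the points of K with respect to Lebesgue measure on the
   affine hull of K, read in affine coordinates t |-> a + t *m B of that hull.
   Two coordinate systems change Lebesgue measure by a constant factor, so c
   does not depend on (a, B); for k = 0 the measure is a point mass and c is
   the only point of K. *)
Definition is_centroid K c :=
  exists (k : nat) (a : 'rV[R]_d) (B : 'M[R]_(k, d)),
    let C := [set t | K (a + row_of_tuple t *m B)] in
    [/\ row_free B,
        affine_hull K = [set a + v *m B | v in [set: 'rV[R]_k]] &
        c = a + (\row_i ((\int[lebesgue_tuple R k]_(t in C) tnth t i) /
                         fine (lebesgue_tuple R k C))) *m B].

Definition centroid K : 'rV[R]_d := xget 0 [set c | is_centroid K c].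

End centroid.

(* A sample is a finite multiset, represented by any sequence listing it. *)
Section sample.
Context {R : realType} {d : nat}.
Implicit Types (s : seq 'rV[R]_d) (x z : 'rV[R]_d).

Definition empirical s (A : set 'rV[R]_d) : R :=
  (count (fun z => `[< A z >]) s)%:R / (size s)%:R.

Definition halfspace_depth s x : R :=
  inf [set empirical s (closed_halfspace u (dot u x)) | u in unit_sphere].

Definition median_region s : set 'rV[R]_d :=
  [set x | halfspace_depth s x = sup (range (halfspace_depth s))].

Definition tukey_median s : 'rV[R]_d := centroid (median_region s).

Definition full_affine_dim s : Prop :=
  affine_hull [set` s] = [set: 'rV[R]_d].

(* The minimum over an empty set of m is +oo. *)
Definition addition_breakdown (E : seq 'rV[R]_d -> 'rV[R]_d) s : \bar R :=
  \big[mine/+oo%E]_(1 <= m < (size s).+1 |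
      `[< ereal_sup [set (enorm (E (s ++ y) - E s))%:E |
                       y in [set: m.-tuple 'rV[R]_d]] = +oo%E >])
    (m%:R / (size s + m)%:R)%:E.

End sample.

Section probability.
Local Open Scope ereal_scope.
Context {R : realType} {d : nat}.

(* The library topology on 'rV[R]_d (sup norm) is the Euclidean one. *)
Definition borel_rV : Type := g_sigma_algebraType (@open 'rV[R]_d).
HB.instance Definition _ := Measurable.on borel_rV.

Definition halfspace_symmetric (F : set 'rV[R]_d -> \bar R) (th : 'rV[R]_d) :=
  forall (u : 'rV[R]_d) (c : R), u != 0%R ->
    closed_halfspace u c th -> (2^-1)%:E <= F (closed_halfspace u c).

Definition smooth_at (F : set 'rV[R]_d -> \bar R) (x0 : 'rV[R]_d) :=
  forall (u : 'rV[R]_d) (c : R), u != 0%R ->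
    hyperplane u c x0 -> F (hyperplane u c) = 0.

End probability.
Arguments borel_rV : clear implicits.

Section iid.
Local Open Scope ereal_scope.
Context {R : realType} {disp disp'} {T : measurableType disp}
  {T' : measurableType disp'} (P : probability T R).

Definition mutually_independent (X : nat -> {RV P >-> T'}) :=
  forall (J : {fset nat}) (A : nat -> set T'),
    (forall j, j \in J -> measurable (A j)) ->
    P (\bigcap_(j in [set` J]) (X j @^-1` A j)) =
    \prod_(j <- J) P (X j @^-1` A j).

Definition iid (F : probability T' R) (X : nat -> {RV P >-> T'}) :=
  mutually_independent X /\
  forall i (A : set T'), measurable A -> distribution P (X i) A = F A.

End iid.

(* Main.v *)
Require Import Defs.
From HB Require Import structures.
From mathcomp Require Import all_boot all_order all_algebra finmap.
From mathcomp Require Import all_classical all_reals all_analysis.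
From mathcomp Require Import measurable_realfun.
From mathcomp Require Import zify ring lra.
Set Implicit Arguments.
Unset Strict Implicit.
Unset Printing Implicit Defensive.
Import Order.TTheory GRing.Theory Num.Theory.
Import numFieldNormedType.Exports.
Local Open Scope classical_set_scope.
Local Open Scope ring_scope.

(* If every closed halfspace bounded by a hyperplane through theta holds at most
   q of the n sample points, then theta keeps depth at least n - q after any
   contamination, whereas a point beyond a supporting halfspace of the sample
   has depth at most m: so m < n - q contaminating points keep the median in the
   convex hull of the sample.  Conversely q + 1 copies of a single point y make
   y the only median: from any x <> y, tilting slightly towards y a direction
   orthogonal to theta - x gives a halfspace at x that misses y and holds at most
   q sample points.  Thus the breakdown point lies between (n - q)/(2n - q) and
   (q + 1)/(n + q + 1), and both tend to 1/3 once q/n -> 1/2.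

   Symmetry and smoothness make every hyperplane through theta halve F.
   Compactness of the sphere covers the halfspaces at theta by finitely many
   cones of F-mass below 1/2 + e, and a Chernoff bound with Borel-Cantelli
   controls the number of sample points in each cone almost surely. *)

(** * Euclidean dot product *)

Section dot_product.
Context {R : realType} {d : nat}.
Implicit Types (u v x y z : 'rV[R]_d) (a : R).

Lemma dotE u x : dot u x = \sum_j u 0 j * x 0 j.
Proof. by rewrite /dot mxE; apply: eq_bigr => j _; rewrite mxE. Qed.

Lemma dotC u x : dot u x = dot x u.
Proof. by rewrite !dotE; apply: eq_bigr => j _; rewrite mulrC. Qed.

Lemma dotDl u v x : dot (u + v) x = dot u x + dot v x.
Proof. by rewrite /dot mulmxDl mxE. Qed.

Lemma dotZl a u x : dot (a *: u) x = a * dot u x.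
Proof. by rewrite /dot -scalemxAl mxE. Qed.

Lemma dotNl u x : dot (- u) x = - dot u x.
Proof. by rewrite -scaleN1r dotZl mulN1r. Qed.

Lemma dotDr u x y : dot u (x + y) = dot u x + dot u y.
Proof. by rewrite dotC dotDl !(dotC u). Qed.

Lemma dotNr u x : dot u (- x) = - dot u x.
Proof. by rewrite dotC dotNl (dotC u). Qed.

Lemma dotBr u x y : dot u (x - y) = dot u x - dot u y.
Proof. by rewrite dotDr dotNr. Qed.

Lemma dotZr a u x : dot u (a *: x) = a * dot u x.
Proof. by rewrite dotC dotZl (dotC u). Qed.

Lemma dot_sumr (I : finType) u (f : I -> 'rV[R]_d) :
  dot u (\sum_i f i) = \sum_i dot u (f i).
Proof.
apply: (big_morph (dot u) (dotDr u)).
by rewrite -(scale0r (0 : 'rV_d)) dotZr mul0r.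
Qed.

Lemma dot_delta j x : dot (delta_mx 0 j) x = x 0 j.
Proof.
rewrite dotE (bigD1 j)//= mxE !eqxx mul1r big1 ?addr0// => i ij.
by rewrite mxE (negbTE ij) andbF mul0r.
Qed.

Lemma dot_ge0 u : 0 <= dot u u.
Proof. by rewrite dotE sumr_ge0// => j _; rewrite -expr2 sqr_ge0. Qed.

Lemma dot_gt0 u : u != 0 -> 0 < dot u u.
Proof.
move=> u0; rewrite lt_neqAle dot_ge0 andbT eq_sym; apply: contra u0.
rewrite dotE psumr_eq0 => [/allP h|j _]; last by rewrite -expr2 sqr_ge0.
apply/eqP/rowP => j; rewrite mxE; apply/eqP.
by have := h j (mem_index_enum _); rewrite /= mulf_eq0 orbb.
Qed.

Lemma enorm_gt0 u : u != 0 -> 0 < enorm u.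
Proof. by move=> u0; rewrite sqrtr_gt0 dot_gt0. Qed.

Lemma unit_sphere_normalize u : u != 0 -> unit_sphere ((enorm u)^-1 *: u).
Proof.
move=> u0; rewrite /unit_sphere /= {1}/enorm dotZl dotZr mulrA.
rewrite -(sqr_sqrtr (dot_ge0 u)) -/(enorm u) -expr2 -exprMn mulVf ?expr1n ?sqrtr1//.
by rewrite gt_eqF// enorm_gt0.
Qed.

Lemma unit_sphere_neq0 u : unit_sphere u -> u != 0.
Proof.
rewrite /unit_sphere /=; apply: contra_eqN => /eqP ->.
by rewrite /enorm -(scale0r (0 : 'rV_d)) dotZl mul0r sqrtr0 eq_sym oner_eq0.
Qed.

(** The kernel of the column [x^T] has dimension at least [d - 1]. *)
Lemma exists_orthogonal x : (2 <= d)%N -> exists2 u : 'rV[R]_d, u != 0 & dot u x = 0.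
Proof.
move=> d2; exists (nz_row (kermx x^T)).
  rewrite nz_row_eq0 -mxrank_eq0 mxrank_ker -lt0n subn_gt0 mxrank_tr.
  by rewrite (leq_ltn_trans (rank_leq_row _)).
have /sub_kermxP h := nz_row_sub (kermx x^T).
by rewrite /dot h mxE.
Qed.

End dot_product.

Lemma leq_count_in (T : eqType) (a b : pred T) (s : seq T) :
  {in s, subpred a b} -> (count a s <= count b s)%N.
Proof.
elim: s => //= x s IH ab; apply: leq_add.
  by have := ab x (mem_head _ _); case: (a x) => // ->.
by apply: IH => y ys; apply: ab; rewrite inE ys orbT.
Qed.

(** * Halfspace depth and median regions *)

Section halfspace_count.
Context {R : realType} {d : nat}.
Implicit Types (u v x y z : 'rV[R]_d) (c : R) (s : seq 'rV[R]_d).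

Definition halfspace_count s u c : nat := count (fun z => dot u z <= c) s.

Lemma empirical_halfspace s u c :
  empirical s (closed_halfspace u c) = (halfspace_count s u c)%:R / (size s)%:R.
Proof.
by congr (_%:R / _); apply: eq_count => z; rewrite /closed_halfspace/= asboolb.
Qed.

Lemma halfspace_countZ s u x a : 0 < a ->
  halfspace_count s (a *: u) (dot (a *: u) x) = halfspace_count s u (dot u x).
Proof. by move=> a0; apply: eq_count => z; rewrite !dotZl ler_pM2l. Qed.

(** Two opposite closed halfspaces cover the space; this turns an upper bound [q] on all counts at a
    point into the lower bound [size s - q]. *)
Lemma halfspace_count_opp s u c :
  (size s <= halfspace_count s u c + halfspace_count s (- u) (- c))%N.
Proof.
rewrite -(count_predC (fun z => dot u z <= c)) leq_add2l sub_count// => z /=.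
by rewrite dotNl lerN2 -ltNge => /ltW.
Qed.

Lemma halfspace_depth_le s u x : u != 0 ->
  halfspace_depth s x <= (halfspace_count s u (dot u x))%:R / (size s)%:R.
Proof.
move=> u0; apply: ge_inf.
  by exists 0 => _ [v _ <-]; rewrite /empirical divr_ge0.
exists ((enorm u)^-1 *: u); first exact: unit_sphere_normalize.
by rewrite empirical_halfspace halfspace_countZ// invr_gt0 enorm_gt0.
Qed.

Lemma unit_sphere_nonempty : (0 < d)%N -> @unit_sphere R d !=set0.
Proof.
move=> d0; pose u : 'rV[R]_d := delta_mx 0 (Ordinal d0).
exists ((enorm u)^-1 *: u); apply: unit_sphere_normalize.
apply/eqP => /rowP /(_ (Ordinal d0)); rewrite !mxE !eqxx => /eqP.
by rewrite oner_eq0.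
Qed.

Lemma le_halfspace_depth s x (k : nat) : (0 < d)%N ->
  (forall u, u != 0 -> (k <= halfspace_count s u (dot u x))%N) ->
  k%:R / (size s)%:R <= halfspace_depth s x.
Proof.
move=> d0 h; apply: lb_le_inf.
  have [u su] := unit_sphere_nonempty d0.
  by exists (empirical s (closed_halfspace u (dot u x))), u.
move=> _ [u /unit_sphere_neq0 u0 <-]; rewrite empirical_halfspace.
by rewrite ler_wpM2r ?invr_ge0// ler_nat h.
Qed.

Lemma halfspace_depth_le1 s x : (0 < d)%N -> halfspace_depth s x <= 1.
Proof.
move=> d0; have [u /unit_sphere_neq0 u0] := unit_sphere_nonempty d0.
apply: (le_trans (halfspace_depth_le s x u0)).
have [->|s0] := posnP (size s); first by rewrite invr0 mulr0.
by rewrite ler_pdivrMr ?ltr0n// mul1r ler_nat count_size.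
Qed.

Lemma halfspace_depth_le_sup s x : (0 < d)%N ->
  halfspace_depth s x <= sup (range (halfspace_depth s)).
Proof.
move=> d0; apply: ub_le_sup; last by exists x.
by exists 1 => _ [z _ <-]; exact: halfspace_depth_le1.
Qed.

Lemma median_region_max s y :
  (forall x, x != y -> halfspace_depth s x < halfspace_depth s y) ->
  median_region s = [set y].
Proof.
move=> h; have hle x : halfspace_depth s x <= halfspace_depth s y.
  by have [->//|/h/ltW] := eqVneq x y.
have sE : sup (range (halfspace_depth s)) = halfspace_depth s y.
  apply/eqP; rewrite eq_le; apply/andP; split.
    by apply: ge_sup => [|_ [x _ <-]//]; exists (halfspace_depth s y), y.
  by apply: ub_le_sup; [exists (halfspace_depth s y) => _ [x _ <-]|exists y].
apply/seteqP; split=> x /=; rewrite /median_region /= sE; last by move=> ->.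
by move=> e; apply/eqP; apply: contraPT e => /h /lt_eqF/eqP.
Qed.

(** Serves to push a halfspace strictly past its boundary without capturing a new sample point. *)
Lemma exists_gap (L : seq R) b :
  exists2 c, b < c & forall t, t \in L -> b < t -> c <= t.
Proof.
elim: L => [|a L [c bc cL]]; first by exists (b + 1) => //; rewrite ltrDl.
have [ba|ab] := ltP b a; last first.
  exists c => // t; rewrite inE => /predU1P[->|]; last exact: cL.
  by move=> /lt_le_trans/(_ ab); rewrite ltxx.
exists (Num.min c a); first by rewrite lt_min bc.
move=> t; rewrite inE => /predU1P[-> _|tL bt]; first by rewrite ge_min lexx orbT.
by rewrite ge_min cL.
Qed.

(* Equivalent to: K is closed and convex. *)
Definition halfspace_closed (K : set 'rV[R]_d) :=
  forall x, ~ K x -> exists u c, dot u x < c /\ forall z, K z -> c <= dot u z.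

(** A point [x] outside has a halfspace of mass below the supremum. Up to the gap value [c],
    parallel halfspaces capture no further sample points, so every [z] with [dot u z < c] also
    misses the supremum. *)
Lemma median_region_closed s : (0 < d)%N -> halfspace_closed (median_region s).
Proof.
move=> d0 x Kx; set D := sup (range (halfspace_depth s)).
have xD : halfspace_depth s x < D.
  by rewrite lt_neqAle halfspace_depth_le_sup// andbT; apply/eqP.
have [|_ [u su <-] uD] := inf_lt _ xD.
  have [u su] := unit_sphere_nonempty d0.
  by exists (empirical s (closed_halfspace u (dot u x))), u.
have [c xc cL] := exists_gap [seq dot u z | z <- s] (dot u x).
exists u, c; split => // z; rewrite /median_region/= -/D => zD.
have [//|zc] := leP c (dot u z).
have : halfspace_depth s z < D.
  apply: le_lt_trans uD.
  apply: (le_trans (halfspace_depth_le _ z (unit_sphere_neq0 su))).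
  rewrite empirical_halfspace ler_wpM2r ?invr_ge0// ler_nat.
  apply: leq_count_in => w ws wz; rewrite leNgt; apply/negP => xw.
  have := cL _ (map_f (dot u) ws) xw.
  by move=> /le_trans/(_ wz); rewrite leNgt zc.
by rewrite zD ltxx.
Qed.

Lemma halfspace_count_cat s s' u c :
  halfspace_count (s ++ s') u c =
  (halfspace_count s u c + halfspace_count s' u c)%N.
Proof. exact: count_cat. Qed.

Lemma median_region_cat_le s s' th (q : nat) u M : (0 < d)%N ->
  (forall v, v != 0 -> (halfspace_count s v (dot v th) <= q)%N) ->
  (q + size s' < size s)%N ->
  (forall z, z \in s -> dot u z <= M) ->
  forall x, median_region (s ++ s') x -> dot u x <= M.
Proof.
move=> d0 hq qs uM x xK; rewrite leNgt; apply/negP => Mx.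
(* For [u = 0] the bound at any sample point reads [0 <= M]; [qs] forces the sample to be
   nonempty. *)
have u0 : u != 0.
  apply: contraTneq Mx => u0; rewrite -leNgt.
  case: s uM hq qs xK => // z s uM _ _ _.
  have := uM z (mem_head _ _); rewrite u0.
  by rewrite /dot !mul0mx !mxE.
have s0 : (0 < size (s ++ s'))%N.
  by rewrite size_cat addn_gt0 (leq_ltn_trans _ qs).
have : halfspace_depth (s ++ s') x < halfspace_depth (s ++ s') th.
  apply: (@le_lt_trans _ _ ((size s')%:R / (size (s ++ s'))%:R)).
    apply: le_trans (halfspace_depth_le _ x (_ : - u != 0)) _.
      by rewrite oppr_eq0.
    rewrite ler_wpM2r ?invr_ge0// ler_nat halfspace_count_cat.
    rewrite [X in (X + _)%N](_ : _ = 0%N) ?count_size//.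
    apply/eqP; rewrite -leqn0 leqNgt -has_count; apply/hasPn => z zs.
    by rewrite !dotNl lerN2 -ltNge (le_lt_trans (uM _ zs)).
  (* [qs] is strict between integers, so every count at [th] is at least
     [size s - q >= (size s').+1]. *)
  apply: (@lt_le_trans _ _ ((size s').+1%:R / (size (s ++ s'))%:R)).
    by rewrite ltr_pM2r ?ltr_nat// invr_gt0 ltr0n.
  apply: le_halfspace_depth => // v v0; rewrite halfspace_count_cat.
  have := halfspace_count_opp s v (dot v th).
  have := hq (- v); rewrite oppr_eq0 dotNl => /(_ v0).
  move: qs; lia.
apply/negP; rewrite -leNgt xK; exact: halfspace_depth_le_sup.
Qed.

Lemma exists_perturbation s u p x :
  exists2 e, 0 < e &
    forall z, z \in s -> 0 < dot u (z - x) -> 0 < dot (u + e *: p) (z - x).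
Proof.
elim: s => [|a s [e e0 he]]; first by exists 1.
(* The second bound makes the tilt term at [a] smaller than [dot u (a - x)]; the [1 +] keeps the
   denominator positive and the inequality strict. *)
pose e1 := Num.min e (dot u (a - x) / (1 + `|dot p (a - x)|)).
have [ua|ua] := ltP 0 (dot u (a - x)); last first.
  exists e => // z; rewrite inE => /predU1P[->|]; last exact: he.
  by move=> /lt_le_trans/(_ ua); rewrite ltxx.
have D0 : 0 < 1 + `|dot p (a - x)| by rewrite ltr_pwDl.
have e10 : 0 < e1 by rewrite lt_min e0 divr_gt0.
exists e1 => // z; rewrite inE => /predU1P[-> _|zs uz].
  rewrite dotDl dotZl -ltrBlDr sub0r.
  apply: (@le_lt_trans _ _ (e1 * `|dot p (a - x)|)).
    by rewrite -mulrN ler_wpM2l ?(ltW e10)// -normrN ler_norm.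
  apply: (@lt_le_trans _ _ (e1 * (1 + `|dot p (a - x)|))).
    by rewrite ltr_pM2l// ltrDr.
  by rewrite -ler_pdivlMr// ge_min lexx orbT.
have := he z zs uz; rewrite !dotDl !dotZl => h.
have [pz|pz] := leP 0 (dot p (z - x)); first by rewrite ltr_pwDl// mulr_ge0// ltW.
by apply: (lt_le_trans h); rewrite lerD2l ler_wnM2r ?(ltW pz)// ge_min lexx.
Qed.

Lemma separating_halfspace_count s th x y (q : nat) : (2 <= d)%N -> x != y ->
  (forall v, v != 0 -> (halfspace_count s v (dot v th) <= q)%N) ->
  exists2 u, dot u x < dot u y & (halfspace_count s u (dot u x) <= q)%N.
Proof.
move=> d2 xy hq.
(* Orthogonality to [th - x] puts [x] on the same hyperplane as [th]; the sign of [u] is chosen so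
   that [y] is not behind it. *)
have [u [u0 uth uy]] : exists u : 'rV[R]_d,
    [/\ u != 0, dot u (th - x) = 0 & 0 <= dot u (y - x)].
  have [u u0 uth] := exists_orthogonal (th - x) d2.
  have [uy|uy] := leP 0 (dot u (y - x)); first by exists u.
  by exists (- u); rewrite oppr_eq0 !dotNl uth oppr0 oppr_ge0 ltW.
have [e e0 he] := exists_perturbation s u (y - x) x.
exists (u + e *: (y - x)).
  rewrite -subr_gt0 -dotBr dotDl dotZl ltr_wpDl// mulr_gt0// dot_gt0//.
  by rewrite subr_eq0 eq_sym.
(* A sample point strictly beyond the hyperplane through [th] stays strictly beyond after the tilt,
   so the tilted halfspace at [x] captures only points counted at [th]. *)
apply: leq_trans (hq u u0); apply: leq_count_in => z zs; apply: contraTT.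
rewrite -!ltNge => thz; rewrite -subr_gt0 -dotBr he// dotBr subr_gt0.
by move: thz uth; rewrite dotBr => + /subr0_eq <-.
Qed.

Lemma median_region_cat_nseq s th y (m q : nat) : (2 <= d)%N -> (q < m)%N ->
  (forall v, v != 0 -> (halfspace_count s v (dot v th) <= q)%N) ->
  median_region (s ++ nseq m y) = [set y].
Proof.
move=> d2 qm hq; apply: median_region_max => x xy.
have [u uxy uq] := separating_halfspace_count d2 xy hq.
have u0 : u != 0.
  by apply: contraTneq uxy => ->; rewrite /dot !mul0mx !mxE ltxx.
apply: le_lt_trans (halfspace_depth_le _ x u0) _.
apply: (@lt_le_trans _ _ (m%:R / (size (s ++ nseq m y))%:R)).
  rewrite ltr_pM2r; last by rewrite invr_gt0 ltr0n size_cat size_nseq; lia.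
  rewrite ltr_nat halfspace_count_cat /halfspace_count count_nseq.
  by rewrite leNgt uxy mul0n addn0 (leq_ltn_trans uq).
apply: le_halfspace_depth => [|v v0]; first exact: ltn_trans d2.
by rewrite halfspace_count_cat /halfspace_count count_nseq lexx mul1n leq_addl.
Qed.

End halfspace_count.

(** * Finite convex combinations and relative interior points *)

Lemma big_option (V : nmodType) (I : finType) (F : option I -> V) :
  \sum_o F o = F None + \sum_i F (Some i).
Proof.
rewrite (bigD1 None)//=; congr (_ + _).
by rewrite (reindex_omap Some id) => [|[]]//; apply: eq_bigl => i; rewrite eqxx.
Qed.

Section finite_convexity.
Context {R : realType} {d : nat}.
Implicit Types (K : set 'rV[R]_d).

(** A linear functional bounded below by [c] on all [p i] is bounded below by [c] on their weighted
    mean, so no halfspace separates the mean from [K]. *)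
Lemma halfspace_closed_convex K (I : finType) (w : I -> R) (p : I -> 'rV[R]_d) :
  halfspace_closed K -> (forall i, K (p i)) -> (forall i, 0 <= w i) ->
  \sum_i w i = 1 -> K (\sum_i w i *: p i).
Proof.
move=> cK Kp w0 w1; apply: contrapT => /cK[u [c [+ cu]]].
apply/negP; rewrite -leNgt dot_sumr -[c]mul1r -w1 mulr_suml.
by apply: ler_sum => i _; rewrite dotZr ler_wpM2l// cu.
Qed.

Lemma sub_affine_hull K : K `<=` affine_hull K.
Proof.
move=> x Kx; exists 1%N, (fun=> x), (fun=> 1).
by split=> //; rewrite big_ord1 ?scale1r.
Qed.

(* Write a and the points a + e_j B as affine combinations of finitely many points
   of K: moving away from the barycentre of these points changes the weights
   1/N continuously, so they remain nonnegative nearby. *)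
Lemma halfspace_closed_interior K k (a : 'rV[R]_d) (B : 'M[R]_(k, d)) :
  halfspace_closed K -> row_free B ->
  affine_hull K = [set a + v *m B | v in [set: 'rV[R]_k]] ->
  exists (b : 'rV[R]_k) (r : R), 0 < r /\
    forall v : 'rV[R]_k, (forall i, `|b 0 i - v 0 i| < r) -> K (a + v *m B).
Proof.
move=> cK fB hK.
(* The images of [0] and of the basis vectors form an affine frame of the hull; [I] below indexes
   all points of [K] used to express them. *)
pose e (o : option 'I_k) : 'rV[R]_k := if o is Some j then delta_mx 0 j else 0.
have /choice[f hf] : forall o,
    exists f : {n : nat & ('I_n -> 'rV[R]_d) * ('I_n -> R)}%type,
    [/\ forall i, K ((projT2 f).1 i), \sum_i (projT2 f).2 i = 1 &
        a + e o *m B = \sum_i (projT2 f).2 i *: (projT2 f).1 i].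
  move=> o; have : affine_hull K (a + e o *m B) by rewrite hK; exists (e o).
  by case=> n [p [w h]]; exists (existT _ n (p, w)).
pose I : finType := {o : option 'I_k & 'I_(projT1 (f o))}.
pose p (x : I) := (projT2 (f (tag x))).1 (tagged x).
pose w (x : I) := (projT2 (f (tag x))).2 (tagged x).
have Kp x : K (p x) by have [h _ _] := hf (tag x); apply: h.
have sumI (V : nmodType) (F : forall o, 'I_(projT1 (f o)) -> V) :
    \sum_(x : I) F (tag x) (tagged x) = \sum_o \sum_i F o i.
  by rewrite (sig_big_dep _ _ F).
pose N : R := #|I|%:R.
have N0 : 0 < N.
  rewrite ltr0n lt0n; apply/negP => /eqP/card0_eq I0.
  have [_ + _] := hf None; rewrite big1 => [/eqP|i _]; first by rewrite eq_sym oner_eq0.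
  by have := I0 (existT _ None i : I); rewrite inE.
have /choice[v hv] : forall x, exists v, p x = a + v *m B.
  by move=> x; have := sub_affine_hull (Kp x); rewrite hK => -[v _ <-]; exists v.
pose b := N^-1 *: \sum_x v x.
have bE : a + b *m B = \sum_x N^-1 *: p x.
  rewrite -scaler_sumr (eq_bigr _ (fun x _ => hv x)) big_split/=.
  rewrite sumr_const -scaler_nat -mulmx_suml scalerDr scalerA mulVf ?gt_eqF//.
  by rewrite scale1r scalemxAl.
pose W : R := 1 + \sum_x `|w x|.
have W0 : 0 < W by rewrite ltr_pwDl// sumr_ge0.
have wW x : `|w x| <= W by rewrite /W (bigD1 x)//= addrCA lerDl addr_ge0// sumr_ge0.
(* With [|sg o| <= k.+1 * r] and [|w x| <= W], this radius keeps every weight perturbation at most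
   [N^-1]. *)
pose r := N^-1 / (k.+1%:R * W).
have r0 : 0 < r by rewrite divr_gt0 ?invr_gt0// mulr_gt0.
exists b, r; split => // t ht.
(* Coefficients of [t - b] in the frame: they sum to 0, so the perturbed weights still sum to 1. *)
pose sg (o : option 'I_k) : R :=
  if o is Some j then (t - b) 0 j else - \sum_j (t - b) 0 j.
have sgr o : `|sg o| <= k.+1%:R * r.
  have hj j : `|(t - b) 0 j| <= r by rewrite mxE [(- b) 0 j]mxE distrC; apply/ltW/ht.
  case: o => [j|] /=.
    by apply: (le_trans (hj j)); rewrite ler_peMl ?(ltW r0)// ler1n.
  rewrite normrN; apply: (le_trans (ler_norm_sum _ _ _)).
  apply: (@le_trans _ _ (\sum_(j < k) r)); first exact: ler_sum.
  by rewrite sumr_const card_ord mulr_natl ler_wpMn2l// ltW.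
have sg0 : \sum_o sg o = 0.
  by rewrite big_option/= addNr.
have sge : \sum_o sg o *: e o = t - b.
  rewrite big_option/= scaler0 add0r [RHS]matrix_sum_delta big_ord1.
  by apply: eq_bigr.
have -> : a + t *m B = \sum_x (N^-1 + sg (tag x) * w x) *: p x.
  under eq_bigr do rewrite scalerDl.
  rewrite big_split/= -bE.
  rewrite (sumI _ (fun o i => (sg o * (projT2 (f o)).2 i) *: (projT2 (f o)).1 i)).
  under eq_bigr => o _.
    under eq_bigr do rewrite -scalerA.
    rewrite -scaler_sumr; have [_ _ <-] := hf o.
    rewrite scalerDr scalemxAl; over.
  rewrite big_split/= -scaler_suml sg0 scale0r add0r -mulmx_suml sge mulmxBl.
  by rewrite -addrA [_ *m B + _]addrC subrK.
apply: halfspace_closed_convex => //.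
- move=> x; rewrite -lerBlDr sub0r.
  apply: (@le_trans _ _ `|sg (tag x) * w x|); first by rewrite -normrN ler_norm.
  rewrite normrM; apply: (@le_trans _ _ (k.+1%:R * r * W)).
    by rewrite ler_pM.
  by rewrite /r [k.+1%:R * _]mulrC -!mulrA mulVf ?mulr1// gt_eqF// mulr_gt0.
- rewrite big_split/= sumr_const -mulr_natl mulfV ?gt_eqF//.
  rewrite (sumI _ (fun o i => sg o * (projT2 (f o)).2 i)).
  under eq_bigr => o _ do (rewrite -mulr_sumr; have [_ -> _] := hf o; rewrite mulr1).
  by rewrite sg0 addr0.
Qed.

End finite_convexity.

(** * Lebesgue measure on tuples *)

Section tuple_box.
Context {R : realType}.
Local Notation RT := (measurableTypeR R).

Definition tuple_box k (c : 'I_k -> R) (r : R) : set (k.-tuple RT) :=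
  [set t | forall i, ball (c i) r (tnth t i)].

Lemma measurable_tuple_box k (c : 'I_k -> R) r : measurable (tuple_box c r).
Proof.
rewrite (_ : tuple_box c r = \bigcap_i ((@tnth k RT)^~ i @^-1` ball (c i) r)).
  apply: fin_bigcap_measurable => // i _; rewrite -[X in measurable X]setTI.
  by apply: (measurable_tnth i) => //; rewrite ball_itv; exact: measurable_itv.
by apply/seteqP; split=> t /= h i; [move=> _; exact: h|exact: h].
Qed.

Lemma lebesgue_tuple_box k (c : 'I_k -> R) r : 0 <= r ->
  lebesgue_tuple R k (tuple_box c r) = ((r *+ 2) ^+ k)%:E.
Proof.
move=> r0; elim: k c => [c|k IH c] /=.
  have c0 : tuple_box c r [tuple] by case.
  by rewrite diracE expr0 mem_set.
rewrite /lebesgue_cons /pushforward.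
rewrite (_ : _ @^-1` _ = ball (c ord0) r `*` tuple_box (c \o lift ord0) r).
  transitivity (lebesgue_measure (ball (c ord0) r) *
                lebesgue_tuple R k (tuple_box (c \o lift ord0) r))%E.
    apply: product_measure1E; last exact: measurable_tuple_box.
    by rewrite ball_itv; exact: measurable_itv.
  by rewrite lebesgue_measure_ball// IH -EFinM exprS.
apply/seteqP; split => -[x t] /=.
  move=> h; split => [|i]; first exact: (h ord0).
  by have := h (lift ord0 i); rewrite tnthS.
move=> [hx ht] i; case: (unliftP ord0 i) => [j ->|-> //].
by rewrite tnthS; exact: ht.
Qed.

(** Tuples carry the product sigma-algebra, and an open set is the union of the countably many cubes
    with rational centre and radius [n.+1%:R^-1] contained in it. *)
Lemma measurable_preimage_row_of_tuple k (U : set 'rV[R]_k) : open U ->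
  measurable (@row_of_tuple R k @^-1` U).
Proof.
move=> oU; pose box (p : 'rV[rat]_k * nat) :=
  tuple_box (fun i => ratr (p.1 0 i)) (p.2.+1%:R^-1).
rewrite (_ : _ @^-1` _ = \bigcup_p
   (if `[< box p `<=` @row_of_tuple R k @^-1` U >] then box p else set0)).
  apply: countable_bigcupT_measurable => [|p]; first exact: countableP.
  by case: ifP => // _; exact: measurable_tuple_box.
apply/seteqP; split => [t /= Ut|t [p _]]; last by case: asboolP => // h /h.
have /nbhs_ballP[e /= e0 eU] : nbhs (row_of_tuple t) U by exact: open_nbhs_nbhs.
(* With radius below [e / 2], a cube containing [t] lies within [e] of [t]. *)
have [n ne] : exists n, n.+1%:R^-1 < e / 2 :> R.
  have := near_infty_natSinv_lt (PosNum (divr_gt0 e0 (ltr0Sn R 1))).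
  by case=> n _ /(_ n (leqnn _)) => h; exists n.
have /choice[q hq] : forall i, exists q : rat, ball (ratr q : R) n.+1%:R^-1 (tnth t i).
  move=> i; have [|q] := @rat_in_itvoo R (tnth t i - n.+1%:R^-1) (tnth t i + n.+1%:R^-1).
    by rewrite ltrD2l (@lt_trans _ _ 0)// ?oppr_lt0 invr_gt0.
  rewrite in_itv/= => h; exists q.
  by rewrite /ball/= distrC ltr_distlC.
exists (\row_i q i, n) => //=.
have tb : box (\row_i q i, n) t by move=> i; rewrite /= mxE.
case: asboolP => // -[] t' tb' /=; apply: eU; split=> // i j; rewrite !mxE.
have := tb' j; rewrite /= mxE /ball/= => qt'.
have := hq j; rewrite /ball/= distrC => qt.
apply: (le_lt_trans (ler_distD (ratr (q j)) _ _)).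
by rewrite [e]splitr ltrD// ?(lt_trans qt)// (lt_trans qt').
Qed.

End tuple_box.

Lemma dot_continuous {R : realType} {d : nat} (u : 'rV[R]_d) : continuous (dot u).
Proof.
have -> : dot u = (fun x => \sum_j u 0 j * x 0 j) by apply/funext => x; exact: dotE.
apply: continuous_big => [|j _]; first exact: add_continuous.
move=> x; apply: (@cvgMl_tmp _ _ (nbhs x)); exact: (@coord_continuous R 1 d 0 j x).
Qed.

Lemma Rintegral_sum d (T : measurableType d) (R : realType)
    (mu : {measure set T -> \bar R}) (D : set T) (I : Type) (s : seq I)
    (F : I -> T -> R) : measurable D ->
  (forall i, mu.-integrable D (EFin \o F i)) ->
  mu.-integrable D (EFin \o (fun x => \sum_(i <- s) F i x)) /\
  \int[mu]_(x in D) (\sum_(i <- s) F i x) = \sum_(i <- s) \int[mu]_(x in D) F i x.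
Proof.
move=> mD iF; elim: s => [|i s [iS IS]].
  rewrite (_ : (fun x => _) = cst 0); last by apply/funext => x; rewrite big_nil.
  rewrite big_nil Rintegral_cst// mul0r; split => //.
  exact: (@integrable0 _ _ _ mu).
rewrite (_ : (fun x => _) = (fun x => F i x + \sum_(j <- s) F j x)); last first.
  by apply/funext => x; rewrite big_cons.
rewrite big_cons RintegralD// IS; split => //.
by have := integrableD mD (iF i) iS; apply: eq_integrable.
Qed.

Lemma dot_mulmx {R : realType} {d k : nat} (u : 'rV[R]_d) (w : 'rV[R]_k)
  (B : 'M[R]_(k, d)) : dot u (w *m B) = dot (u *m B^T) w.
Proof. by rewrite /dot trmx_mul mulmxA. Qed.

(** * Centroids stay in supporting halfspaces *)

Section centroid_bound.
Context {R : realType} {d : nat}.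
Variables (K : set 'rV[R]_d) (N : R).
Hypotheses (cK : halfspace_closed K)
  (bK : forall x, K x -> forall j, `|x 0 j| <= N).

Let coord_set k (a : 'rV[R]_d) (B : 'M[R]_(k, d)) :=
  [set t | K (a + row_of_tuple t *m B)].

(** The complement is open: a halfspace that cuts off one of its points cuts off a neighbourhood. *)
Lemma measurable_coord_set k (a : 'rV[R]_d) (B : 'M[R]_(k, d)) :
  measurable (coord_set a B).
Proof.
rewrite -[coord_set a B]setCK; apply: measurableC.
apply: (@measurable_preimage_row_of_tuple _ _ [set v | ~ K (a + v *m B)]).
rewrite openE => v /= /cK[u [c [uc cu]]].
have ug w : dot u (a + w *m B) = dot u a + dot (u *m B^T) w.
  by rewrite dotDr dot_mulmx.
have : \forall w \near v, dot (u *m B^T) w < c - dot u a.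
  by apply: (cvgr_lt _ (@dot_continuous _ _ _ v)); rewrite ltrBrDl -ug.
apply: filterS => w; rewrite ltrBrDl -ug => uw /cu.
by rewrite leNgt uw.
Qed.

(** A right inverse [B'] of [B] recovers the coordinates from points of [K], which are bounded. *)
Lemma coord_set_bounded k (a : 'rV[R]_d) (B : 'M[R]_(k, d)) : row_free B ->
  exists L, forall t, coord_set a B t -> forall i, `|tnth t i| <= L.
Proof.
move=> /row_freeP[B' BB'].
exists (\sum_i \sum_j (N + `|a 0 j|) * `|B' j i|) => t Ct i.
have -> : tnth t i = \sum_j ((a + row_of_tuple t *m B) 0 j - a 0 j) * B' j i.
  transitivity ((row_of_tuple t *m B *m B') 0 i).
    by rewrite -mulmxA BB' mulmx1 mxE.
  by rewrite mxE; apply: eq_bigr => j _; rewrite [(a + _) 0 j]mxE addrC addKr.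
have N0 j : 0 <= (N + `|a 0 j|) by rewrite addr_ge0// (le_trans _ (bK Ct j)).
apply: (@le_trans _ _ (\sum_j (N + `|a 0 j|) * `|B' j i|)); last first.
  rewrite [leRHS](bigD1 i)//= lerDl sumr_ge0// => i' _.
  by rewrite sumr_ge0// => j _; rewrite mulr_ge0.
apply: (le_trans (ler_norm_sum _ _ _)); apply: ler_sum => j _.
rewrite normrM ler_wpM2r// (le_trans (ler_normB _ _))// lerD2r.
exact: bK.
Qed.

Lemma coord_set_ltoo k (a : 'rV[R]_d) (B : 'M[R]_(k, d)) : row_free B ->
  (lebesgue_tuple R k (coord_set a B) < +oo)%E.
Proof.
move=> /(coord_set_bounded a)[L hL].
apply: (@le_lt_trans _ _ (lebesgue_tuple R k (tuple_box (fun=> 0) (`|L| + 1)))).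
  apply: le_measure; rewrite ?inE; first exact: measurable_coord_set.
    exact: measurable_tuple_box.
  move=> t /hL tL i; rewrite /ball/= sub0r normrN.
  by rewrite (le_lt_trans (tL i))// ltr_pwDr// ler_norm.
by rewrite lebesgue_tuple_box ?ltry// addr_ge0.
Qed.

(* Were this measure 0, the quotient in is_centroid would be 0 and the centroid
   would degenerate to the arbitrary base point a. *)
Lemma coord_set_gt0 k (a : 'rV[R]_d) (B : 'M[R]_(k, d)) : row_free B ->
  affine_hull K = [set a + v *m B | v in [set: 'rV[R]_k]] ->
  (0 < lebesgue_tuple R k (coord_set a B))%E.
Proof.
move=> fB hK; have [b [r [r0 br]]] := halfspace_closed_interior cK fB hK.
apply: (@lt_le_trans _ _ (lebesgue_tuple R k (tuple_box (b 0) r))).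
  by rewrite lebesgue_tuple_box ?(ltW r0)// lte_fin exprn_gt0// pmulrn_lgt0.
apply: le_measure; rewrite ?inE; first exact: measurable_tuple_box.
  exact: measurable_coord_set.
by move=> t tb; apply: br => i; rewrite mxE; exact: tb.
Qed.

(** In coordinates [dot u] is affine, so its value at the centroid is its mean over the coordinate
    set, whose measure is positive and finite; a mean of values at most [M] is at most [M]. *)
Lemma centroid_dot_le c u M : is_centroid K c ->
  (forall x, K x -> dot u x <= M) -> dot u c <= M.
Proof.
case=> k [a [B /= [fB hK ->]]] uM; rewrite -/(coord_set a B).
set C := coord_set a B; set mu := lebesgue_tuple R k.
have mC : measurable C by exact: measurable_coord_set.
have Coo : (mu C < +oo)%E by exact: coord_set_ltoo.
have V0 : 0 < fine (mu C) by rewrite fine_gt0// Coo andbT coord_set_gt0.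
have [L hL] := coord_set_bounded a fB.
have it i : mu.-integrable C (EFin \o (fun t => tnth t i)).
  apply: measurable_bounded_integrable => //.
    by apply: measurable_funS (measurable_tnth i).
  exists L; split; first exact: num_real.
  by move=> y Ly t /= Ct; apply: (le_trans (hL _ Ct i)); exact: ltW.
set g := u *m B^T.
have ig i : mu.-integrable C (EFin \o (fun t => g 0 i * tnth t i)).
  by have := integrableZl mC (g 0 i) (it i); apply: eq_integrable.
have [is_ Is] := Rintegral_sum (index_enum 'I_k) mC ig.
rewrite dotDr dot_mulmx -/g [dot g _]dotE -lerBrDl.
under eq_bigr => i _ do rewrite mxE mulrA -RintegralZl//.
rewrite -mulr_suml ler_pdivrMr// -Is -Rintegral_cst//.
apply: le_Rintegral => //.
  apply: measurable_bounded_integrable => //; exact: bounded_cst.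
move=> t Ct; have := uM _ Ct; rewrite dotDr dot_mulmx -/g [dot g _]dotE lerBrDl.
by under eq_bigr => i _ do rewrite [row_of_tuple t 0 i]mxE.
Qed.

End centroid_bound.

(** * Addition breakdown of the median *)

Section tukey_median.
Context {R : realType} {d : nat}.
Implicit Types (x y u : 'rV[R]_d) (K : set 'rV[R]_d) (s : seq 'rV[R]_d).

Lemma coordB x y j : (x - y) 0 j = x 0 j - y 0 j.
Proof. by rewrite !mxE. Qed.

Lemma norm_coord_le_enorm x j : `|x 0 j| <= enorm x.
Proof.
rewrite -sqrtr_sqr ler_wsqrtr// dotE (bigD1 j)//= -expr2 lerDl sumr_ge0// => i _.
by rewrite -expr2 sqr_ge0.
Qed.

Lemma enorm_le x (b : 'I_d -> R) : (forall j, `|x 0 j| <= b j) ->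
  enorm x <= Num.sqrt (\sum_j b j ^+ 2).
Proof.
move=> xb; rewrite ler_wsqrtr// dotE ler_sum// => j _.
rewrite -expr2 -real_normK ?num_real//.
by rewrite ler_sqr ?nnegrE// (le_trans _ (xb j)).
Qed.

(** Zero-dimensional coordinates exhibit a centroid, so [xget] returns one; any centroid has its
    coordinates bounded on both sides by those of [y]. *)
Lemma centroid_set1 y : centroid [set y] = y.
Proof.
have cy : halfspace_closed [set y].
  move=> x xy; exists (y - x), (dot (y - x) y); split => [|z ->//].
  by rewrite -subr_gt0 -dotBr dot_gt0// subr_eq0; apply/eqP => /esym.
have [c cE] : exists c, is_centroid [set y] c.
  eexists; exists 0%N, y, 0; split; last reflexivity.
    by rewrite /row_free mxrank0.
  apply/seteqP; split => x /=.
    move=> [k [p [w [py w1 ->]]]]; exists 0 => //; rewrite mulmx0 addr0.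
    rewrite (eq_bigr (fun i => w i *: y)); last by move=> i _; rewrite (py i).
    by rewrite -scaler_suml w1 scale1r.
  by move=> [v _ <-]; rewrite mulmx0 addr0; exact: sub_affine_hull.
have := xgetPex 0 (ex_intro _ c cE); rewrite -/(centroid _) => h.
apply/rowP => j; apply/eqP; rewrite eq_le.
have by_ x : [set y] x -> forall j, `|x 0 j| <= \sum_i `|y 0 i|.
  by move=> -> i; rewrite (bigD1 i)//= lerDl sumr_ge0.
rewrite -!(dot_delta j) (centroid_dot_le cy by_ h) => [|_ ->//].
rewrite -lerN2 -!dotNl (centroid_dot_le cy by_ h)// => _ ->; exact: lexx.
Qed.

Lemma centroid_coord_le K M : halfspace_closed K -> 0 <= M ->
  (forall x, K x -> forall j, `|x 0 j| <= M) ->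
  forall j, `|centroid K 0 j| <= M.
Proof.
(* Without a centroid, [xget] returns the default 0, which meets the bound as [0 <= M]. *)
move=> cK M0 KM j; rewrite /centroid; case: xgetP => [c _ hc|_]; last by rewrite mxE normr0.
rewrite ler_norml lerNl -!(dot_delta j) -dotNl.
rewrite !(centroid_dot_le cK KM hc)// => x /KM/(_ j); rewrite ?dotNl dot_delta.
  by apply: le_trans; rewrite ler_norm.
by apply: le_trans; rewrite -normrN ler_norm.
Qed.

Lemma seq_coord_bound s :
  exists2 M, 0 <= M & forall z, z \in s -> forall j, `|z 0 j| <= M.
Proof.
elim: s => [|a s [M M0 hM]]; first by exists 0.
exists (M + \sum_j `|a 0 j|) => [|z]; first by rewrite addr_ge0// sumr_ge0.
rewrite inE => /predU1P[-> j|zs j].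
  by rewrite (bigD1 j)//= addrCA lerDl addr_ge0// sumr_ge0.
by rewrite (le_trans (hM z zs j))// lerDl sumr_ge0.
Qed.

Definition breaks_down s (m : nat) : Prop :=
  ereal_sup [set (enorm (tukey_median (s ++ y) - tukey_median s))%:E |
             y in [set: m.-tuple 'rV[R]_d]] = +oo%E.

(** The added copies sit at distance [A] from the original median, and the contaminated median
    region is exactly their location. *)
Lemma breaks_down_large s th (q m : nat) : (2 <= d)%N -> (q < m)%N ->
  (forall u, u != 0 -> (halfspace_count s u (dot u th) <= q)%N) ->
  breaks_down s m.
Proof.
move=> d2 qm hq; apply/eqyP => A A0.
pose j : 'I_d := Ordinal (ltnW d2).
pose y := tukey_median s + A *: delta_mx 0 j.
apply: ereal_sup_ge; exists (enorm (tukey_median (s ++ nseq m y) - tukey_median s))%:E.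
  by exists (nseq_tuple m y).
rewrite /tukey_median (median_region_cat_nseq y d2 qm hq) centroid_set1.
rewrite -/(tukey_median s) /y addrC addKr lee_fin.
apply: le_trans (norm_coord_le_enorm _ j).
by rewrite !mxE !eqxx mulr1 ger0_norm// ltW.
Qed.

(** Below this threshold the contaminated median region stays in every halfspace containing the
    sample, hence in a fixed cube of half-side [M], and so does its centroid: the displacement is
    bounded over all contaminations. *)
Lemma breaks_down_ge s th (q m : nat) : (0 < d)%N ->
  (forall u, u != 0 -> (halfspace_count s u (dot u th) <= q)%N) ->
  breaks_down s m -> (size s <= q + m)%N.
Proof.
move=> d0 hq; apply: contraPT; rewrite -ltnNge => qms bd.
have [M M0 hM] := seq_coord_bound s.
have TM (y : m.-tuple 'rV[R]_d) j : `|tukey_median (s ++ y) 0 j| <= M.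
  apply: centroid_coord_le => // [|x Kx i]; first exact: median_region_closed.
  have qm' : (q + size y < size s)%N by rewrite size_tuple.
  have hz u : (forall z, z \in s -> dot u z <= M) -> dot u x <= M.
    by move=> uM; apply: (median_region_cat_le d0 hq qm' uM Kx).
  rewrite ler_norml lerNl -!(dot_delta i) -dotNl !hz// => z /hM/(_ i).
    by rewrite dot_delta; apply: le_trans; rewrite ler_norm.
  by rewrite dotNl dot_delta; apply: le_trans; rewrite -normrN ler_norm.
have : (ereal_sup [set (enorm (tukey_median (s ++ y) - tukey_median s))%:E |
             y in [set: m.-tuple 'rV[R]_d]] <=
        (Num.sqrt (\sum_j (M + `|tukey_median s 0%R j|) ^+ 2))%:E)%E.
  apply: ge_ereal_sup => _ [y _ <-]; rewrite lee_fin enorm_le// => j.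
  by rewrite coordB (le_trans (ler_normB _ _))// lerD2r.
by rewrite bd.
Qed.

(** The ratio [m / (n + m)] increases with [m]: breakdown needs [m >= n - q], and [m = q + 1], in
    range because [q < n], achieves it. *)
Lemma addition_breakdown_bounds s th (q : nat) : (2 <= d)%N ->
  (forall u, u != 0 -> (halfspace_count s u (dot u th) <= q)%N) ->
  (q < size s)%N ->
  (((size s - q)%:R / (size s + (size s - q))%:R)%:E <=
     addition_breakdown (@tukey_median R d) s)%E /\
  (addition_breakdown (@tukey_median R d) s <=
     (q.+1%:R / (size s + q.+1)%:R)%:E)%E.
Proof.
move=> d2 hq qs; rewrite /addition_breakdown; split.
  apply: le_bigmin => [|m /asboolP bd]; first exact: leey.
  have sqm := breaks_down_ge (ltnW d2) hq bd.
  rewrite lee_fin ler_pdivrMr ?ltr0n; last by lia.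
  rewrite mulrAC ler_pdivlMr ?ltr0n; last by lia.
  rewrite -!natrM ler_nat; nia.
apply: ge_bigmin_seq; first by rewrite mem_index_iota ltnS.
by apply/asboolP; exact: breaks_down_large hq.
Qed.

End tukey_median.

(** * One-sided strong law for independent events *)

Section binomial_deviation.
Context {R : realType} {disp : measure_display} {T : measurableType disp}.
Variables (P : probability T R) (B : nat -> set T) (p : R).
Hypotheses (mB : forall i, measurable (B i))
  (indepB : forall J : {fset nat},
     P (\bigcap_(j in [set` J]) B j) = (p ^+ #|` J|)%:E).

Definition hits (n : nat) (w : T) : nat := count (fun i => w \in B i) (iota 0 n).

Lemma hitsS n w : hits n.+1 w = (hits n w + (w \in B n))%N.
Proof. by rewrite /hits -addn1 iotaD count_cat /= add0n addn0. Qed.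

Lemma event_prob_ge0 : 0 <= p.
Proof.
by have := indepB [fset 0%N]%fset; rewrite cardfs1 expr1 -lee_fin => <-.
Qed.

(** The factor contributed by event [n] is affine in its indicator, so its expectation reduces to
    integrals with and without the restriction to [B n]. *)
Lemma expS_hits (b : R) n w :
  b ^+ hits n.+1 w = b ^+ hits n w + (b - 1) * (\1_(B n) w * b ^+ hits n w).
Proof.
rewrite hitsS exprD indicE; case: (w \in B n) => /=; rewrite ?expr1 ?expr0.
  by rewrite mul1r mulrBl mul1r addrC subrK mulrC.
by rewrite mul0r mulr0 addr0 mulr1.
Qed.

Lemma measurable_exp_hits (b : R) n : measurable_fun setT (fun w => b ^+ hits n w).
Proof.
elim: n => [|n IH]; first exact: measurable_cst.
under eq_fun do rewrite expS_hits.
apply: measurable_funD => //; apply: measurable_funM => //.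
by apply: measurable_funM => //; exact: measurable_indic.
Qed.

(* Integrating over intersections of later events makes the induction on n work
   with the product rule as the only form of independence. *)
Lemma integral_exp_hits (b : R) n (J : {fset nat}) : 1 <= b ->
  (forall j, j \in J -> (n <= j)%N) ->
  (\int[P]_(w in \bigcap_(j in [set` J]) B j) (b ^+ hits n w)%:E =
   (p ^+ #|` J| * (1 + (b - 1) * p) ^+ n)%:E)%E.
Proof.
move=> b1; have b0 : 0 <= b by rewrite (le_trans ler01).
have mJ (I : {fset nat}) : measurable (\bigcap_(j in [set` I]) B j).
  by apply: fin_bigcap_measurable => //; exact: finite_fset.
elim: n J => [|n IH] J nJ.
  rewrite expr0 mulr1 -indepB (eq_integral (cst 1%E))// integral_cst//.
  by rewrite mul1e.
have mG D : measurable_fun D (fun w => (b ^+ hits n w)%:E).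
  by apply/measurable_EFinP; apply: measurable_funS (measurable_exp_hits b n).
under eq_integral do rewrite expS_hits EFinD EFinM.
have m1G D : measurable_fun D (fun w => (\1_(B n) w * b ^+ hits n w)%:E).
  apply/measurable_EFinP; apply: (@measurable_funS _ _ _ _ setT) => //.
  apply: measurable_funM; first exact: measurable_indic.
  exact: measurable_exp_hits.
have G0 w : 0 <= b ^+ hits n w by rewrite exprn_ge0.
have G10 w : 0 <= \1_(B n) w * b ^+ hits n w.
  by rewrite mulr_ge0// indicE.
rewrite ge0_integralD//=; last 3 first.
- by move=> w _; rewrite lee_fin.
- by move=> w _; rewrite -EFinM lee_fin mulr_ge0// subr_ge0.
- exact: measurable_funeM.
rewrite ge0_integralZl//; last 2 first.
- by move=> w _; rewrite lee_fin.
- by rewrite lee_fin subr_ge0.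
have nnJ : n \notin J by apply/negP => /nJ; rewrite ltnn.
rewrite IH; last by move=> j /nJ /ltnW.
(* The indicator of [B n] shrinks the domain of integration, which adds the fresh index [n] to
   [J]. *)
have -> : (\int[P]_(x in \bigcap_(j in [set` J]) B j) (\1_(B n) x * b ^+ hits n x)%:E =
   \int[P]_(x in \bigcap_(j in [set` n |` J]%fset) B j) (b ^+ hits n x)%:E)%E.
  rewrite set_fsetU set_fset1 bigcap_setU1 setIC integral_mkcondr.
  apply: eq_integral => w _; rewrite patchE indicE.
  by case: ifP; rewrite ?mul1r ?mul0r.
rewrite IH; last first.
  by move=> j; rewrite !inE => /orP[/eqP ->//|/nJ /ltnW].
rewrite cardfsU1 nnJ add1n -EFinM -EFinD; congr EFin.
by rewrite !exprS; ring.
Qed.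

(** Makes the Chernoff exponent negative. The chosen [l] solves [l * (1 + q) = q - p], whence
    [p < q * (1 - l)], while [expR (- l) >= 1 - l] gives [(expR l - 1) * (1 - l) <= l]. *)
Lemma expR_deviation q : p < q ->
  exists2 l : R, 0 < l & (expR l - 1) * p < l * q.
Proof.
move=> pq; have p0 := event_prob_ge0.
have q0 : 0 < q by exact: le_lt_trans pq.
pose l := (q - p) / (1 + q).
have q10 : 0 < 1 + q by rewrite addr_gt0.
have l0 : 0 < l by rewrite divr_gt0// subr_gt0.
have lE : l * (1 + q) = q - p by rewrite mulfVK// gt_eqF.
have l1 : l < 1 by rewrite ltr_pdivrMr//; lra.
have pl : p < q * (1 - l) by nra.
exists l => //.
have el : expR l * (1 - l) <= 1.
  rewrite -ler_pdivlMl ?expR_gt0// mulr1 -expRN.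
  by rewrite (le_trans _ (expR_ge1Dx _)).
have e1 : (expR l - 1) * (1 - l) <= l by lra.
have e0 : 0 < expR l - 1 by rewrite subr_gt0 -expR0 ltr_expR.
apply: (@lt_le_trans _ _ ((expR l - 1) * (q * (1 - l)))).
  by rewrite ltr_pM2l.
by rewrite mulrCA (mulrC l) ler_wpM2l// ltW.
Qed.

(** Markov's inequality for [b ^+ hits n w] with [b = expR l] bounds the probability of at least
    [n * q] hits by [r ^+ n] with [r < 1]; these bounds are summable, so Borel-Cantelli applies. *)
Lemma hits_deviation q : p < q ->
  {ae P, forall w, \forall n \near \oo, (hits n w)%:R <= n%:R * q}.
Proof.
move=> pq; have [l l0 lq] := expR_deviation pq.
have p0 := event_prob_ge0.
set b := expR l; have b1 : 1 <= b by rewrite /b -expR0 ler_expR ltW.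
pose E n : set T := [set w | expR (n%:R * (l * q)) <= b ^+ hits n w].
have mE n : measurable (E n).
  rewrite /E -[X in measurable X]setTI.
  by apply: measurable_fun_le => //; exact: measurable_exp_hits.
pose r : R := expR ((b - 1) * p - l * q).
have r1 : r < 1 by rewrite /r -[ltRHS]expR0 ltr_expR subr_lt0.
have PE n : (P (E n) <= (r ^+ n)%:E)%E.
  have h : ((expR (n%:R * (l * q)))%:E * P (E n) <=
           ((1 + (b - 1) * p) ^+ n)%:E)%E.
    have := @integral_exp_hits b n fset0 b1 (fun j => ltac:(by [])).
    rewrite cardfs0 expr0 mul1r set_fset0 bigcap_set0 => <-.
    rewrite -integral_cst//.
    have mG D : measurable_fun D (fun w => (b ^+ hits n w)%:E).
      by apply/measurable_EFinP; apply: measurable_funS (measurable_exp_hits b n).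
    have G0 w : (0%:E <= (b ^+ hits n w)%:E)%E.
      by rewrite lee_fin exprn_ge0// (le_trans ler01).
    apply: (@le_trans _ _ (\int[P]_(w in E n) (b ^+ hits n w)%:E)%E).
      apply: ge0_le_integral => //; first by move=> w _; rewrite lee_fin expR_ge0.
    by apply: ge0_subset_integral => // w _; exact: G0.
  have -> : r ^+ n = (expR (n%:R * (l * q)))^-1 * expR ((b - 1) * p) ^+ n.
    by rewrite /r expRB exprMn exprVn -!expRM_natl mulrC.
  rewrite EFinM -lee_pdivrMl ?invr_gt0 ?expR_gt0// invrK.
  (* Here [1 + x <= expR x] is used with [x = (b - 1) * p]. *)
  apply: (le_trans h); rewrite lee_fin lerXn2r ?nnegrE ?expR_ge0 ?expR_ge1Dx//.
  by rewrite addr_ge0// mulr_ge0// subr_ge0.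
have : P (lim_sup_set E) = 0.
  apply: lim_sup_set_cvg0 => //.
  apply: (@le_lt_trans _ _ (1 / (1 - r))%:E); last exact: ltry.
  apply: lime_le; first exact: is_cvg_nneseries.
  near=> n; apply: (@le_trans _ _ (series (geometric 1 r) n)%:E).
    rewrite /series/= -sumEFin; apply: lee_sum => i _.
    by rewrite /= mul1r; exact: PE.
  by rewrite lee_fin geometric_le_lim ?expR_gt0// ger0_norm// expR_ge0.
move=> PE0; exists (lim_sup_set E); split => //.
  apply: bigcap_measurable => // k _; exact: bigcup_measurable.
move=> w /= nw; apply: contrapT => /= hw; apply: nw.
have [k kE] : exists k, forall j, (k <= j)%N -> ~ E j w.
  apply: contrapT => h; apply: hw => k _; apply: contrapT => hk; apply: h.
  by exists k => j kj Ej; apply: hk; exists j.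
exists k => // n /= kn; have := kE n kn; rewrite /E/=.
move=> /negP; rewrite -ltNge /b -expRM_natl ltr_expR.
by rewrite mulrCA [ltLHS]mulrC ltr_pM2l// => /ltW.
Unshelve. all: by end_near. Qed.

End binomial_deviation.

(** * Uniform deviation over halfspaces at the centre *)

Section sphere_cover.
Context {R : realType} {d : nat}.
Variables (F : probability (borel_rV R d) R) (th : 'rV[R]_d).

Lemma measurable_le_continuous (f : 'rV[R]_d -> R) (c : R) : continuous f ->
  measurable ([set z | f z <= c] : set (borel_rV R d)).
Proof.
move=> cf; rewrite -[X in measurable X]setCK; apply: measurableC.
apply: sub_sigma_algebra; rewrite openE => z /= /negP; rewrite -ltNge => cz.
have : \forall w \near z, c < f w by exact: (cvgr_gt _ (cf z)).
by apply: filterS => w cw /=; apply/negP; rewrite -ltNge.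
Qed.

Definition l1norm (x : 'rV[R]_d) : R := \sum_j `|x 0 j|.

(** The slack is the most that [dot u (z - th)] can change when each coordinate of [u] moves by at
    most [n.+1%:R^-1], so one cone contains the halfspaces at [th] of all nearby directions. *)
Definition cone (u : 'rV[R]_d) (n : nat) : set (borel_rV R d) :=
  [set z | dot u (z - th) <= n.+1%:R^-1 * l1norm (z - th)].

Lemma measurable_cone u n : measurable (cone u n).
Proof.
rewrite /cone (_ : [set _ | _] = [set z : 'rV[R]_d |
   dot u z - n.+1%:R^-1 * l1norm (z - th) <= dot u th]); last first.
  by apply/seteqP; split => z /=; rewrite dotBr lerBlDr lerBlDr addrC.
apply: measurable_le_continuous => z.
apply: (@cvgB _ _ _ (nbhs z)); first exact: dot_continuous.
apply: (@cvgMl_tmp _ _ (nbhs z)); move: z.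
apply: continuous_big => [|j _]; first exact: add_continuous.
move=> z; apply: (@cvg_norm _ _ _ (nbhs z)).
rewrite (_ : (fun x : 'rV[R]_d => _) = (fun x => x 0 j - th 0 j)); last first.
  by apply/funext => x; rewrite !mxE.
rewrite coordB; apply: (@cvgB _ _ _ (nbhs z)); last exact: cvg_cst.
exact: (@coord_continuous R 1 d 0 j z).
Qed.

Lemma cone_bigcap u : \bigcap_n cone u n = closed_halfspace u (dot u th).
Proof.
apply/seteqP; split => z /=; rewrite /closed_halfspace /cone/=; last first.
  move=> zu n _ /=; rewrite dotBr; apply: (@le_trans _ _ 0).
    by rewrite subr_le0.
  by rewrite mulr_ge0 ?invr_ge0// sumr_ge0.
move=> h; rewrite -subr_le0 -dotBr leNgt; apply/negP => t0.
have l0 : 0 <= l1norm (z - th) by rewrite sumr_ge0.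
have [n] : exists n : nat, l1norm (z - th) / dot u (z - th) < n%:R.
  by eexists; apply: archi_boundP; rewrite divr_ge0// ltW.
rewrite ltr_pdivrMr// ltNge => /negP; apply.
have := h n I; rewrite /= ler_pdivlMl//.
by apply: le_trans; rewrite ler_wpM2r ?(ltW t0)// ler_nat.
Qed.

Hypotheses (C2 : halfspace_symmetric F th) (C3 : smooth_at F th).

(** By symmetry the opposite closed halfspace has mass at least 1/2, so the open halfspace has mass
    at most 1/2; by smoothness its boundary adds nothing. *)
Lemma halfspace_half u : u != 0 ->
  (F (closed_halfspace u (dot u th)) <= (2^-1)%:E)%E.
Proof.
move=> u0; set c := dot u th.
have mH v b : measurable (closed_halfspace v b : set (borel_rV R d)).
  by apply: measurable_le_continuous; exact: dot_continuous.
have FN : ((2^-1)%:E <= F (closed_halfspace (- u) (- c)))%E.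
  by apply: C2; rewrite ?oppr_eq0// /closed_halfspace/= dotNl lexx.
have F0 : F (hyperplane u c) = 0%E by exact: C3.
have mh : measurable (hyperplane u c : set (borel_rV R d)).
  rewrite (_ : hyperplane u c = closed_halfspace u c `&` closed_halfspace (- u) (- c)).
    exact: measurableI.
  apply/seteqP; split => z; rewrite /hyperplane/closed_halfspace/= dotNl lerN2.
    by move=> ->; rewrite lexx.
  by move=> [h1 h2]; apply/eqP; rewrite eq_le h1.
apply: (@le_trans _ _ (F (hyperplane u c `|` ~` closed_halfspace (- u) (- c)))).
  apply: le_measure; rewrite ?inE//; first exact: measurableU (measurableC _).
  move=> z; rewrite /hyperplane/closed_halfspace/= dotNl lerN2 le_eqVlt.
  by case/predU1P => [|zc]; [left|right; apply/negP; rewrite -ltNge].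
apply: (le_trans (measureU2 _ _ _)) => //; first exact: measurableC.
rewrite [X in (X + _)%E]F0 add0e.
have /= -> := probability_setC F (mH (- u) (- c)).
rewrite leeBlDr; last exact: fin_num_measure.
rewrite (_ : 1%E = (2^-1 + 2^-1)%:E) ?EFinD ?leeD2l//.
by congr EFin; lra.
Qed.

(** Continuity from above: the cones decrease to the halfspace at [th], whose mass is at most
    1/2. *)
Lemma cone_lt u e : u != 0 -> 0 < e ->
  exists n, (F (cone u n) < (2^-1 + e)%:E)%E.
Proof.
move=> u0 e0; apply: contrapT => h.
have cvgF : F (cone u n) @[n --> \oo] --> F (\bigcap_n cone u n).
  apply: nonincreasing_cvg_mu.
  - by rewrite (le_lt_trans (probability_le1 _ _)) ?ltry//; exact: measurable_cone.
  - exact: measurable_cone.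
  - by apply: bigcapT_measurable => n; exact: measurable_cone.
  - move=> n m nm; apply/subsetPset => z; rewrite /cone/= => /le_trans; apply.
    by rewrite ler_wpM2r ?sumr_ge0// lef_pV2 ?posrE// ler_nat.
suff : ((2^-1 + e)%:E <= F (\bigcap_n cone u n))%E.
  rewrite cone_bigcap => /le_trans/(_ (halfspace_half u0)).
  by rewrite lee_fin gerDl leNgt e0.
rewrite -(cvg_lim _ cvgF)//; apply: lime_ge; first exact: cvgP cvgF.
by apply: nearW => n; rewrite leNgt; apply/negP => hn; apply: h; exists n.
Qed.

Lemma compact_unit_sphere : compact (@unit_sphere R d).
Proof.
apply: (@subclosed_compact _ _
  [set v : 'rV[R]_d | forall i, `[-1, 1]%classic (v ord0 i)]).
- rewrite (_ : unit_sphere = [set u | dot u u = 1]); last first.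
    apply/seteqP; split => u; rewrite /unit_sphere/enorm/=; last first.
      by move=> ->; exact: sqrtr1.
    by move=> h; rewrite -(sqr_sqrtr (dot_ge0 u)) h expr1n.
  apply: (@closed_comp _ _ (fun u : 'rV[R]_d => dot u u) [set 1]).
    move=> u _; rewrite (_ : (fun u : 'rV[R]_d => _) =
                             (fun u => \sum_j u 0 j * u 0 j)); last first.
      by apply/funext => v; exact: dotE.
    move: u; apply: continuous_big => [|j _]; first exact: add_continuous.
    move=> u; apply: (@cvgM _ _ (nbhs u)); exact: (@coord_continuous R 1 d 0 j u).
  exact: closed_eq.
- by apply: (@rV_compact R d (fun=> `[-1, 1]%classic)) => _; exact: segment_compact.
- move=> u; rewrite /unit_sphere/= => u1 i; rewrite in_itv/= -ler_norml -u1.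
  exact: norm_coord_le_enorm.
Qed.

Lemma halfspace_cone (v u : 'rV[R]_d) n : (forall j, `|u 0 j - v 0 j| <= n.+1%:R^-1) ->
  closed_halfspace v (dot v th) `<=` cone u n.
Proof.
move=> uv z; rewrite /closed_halfspace/cone/= -subr_le0 -dotBr => vz.
rewrite -[u](subrK v) dotDl -[leRHS]addr0 lerD//.
rewrite dotE /l1norm mulr_sumr; apply: ler_sum => j _.
rewrite coordB; apply: (le_trans (ler_norm _)); rewrite normrM ler_wpM2r//.
Qed.

Lemma sphere_cover e : 0 < e ->
  exists (D : {fset 'rV[R]_d}) (A : 'rV[R]_d -> set (borel_rV R d)),
    (forall u, u \in D -> measurable (A u) /\ (F (A u) < (2^-1 + e)%:E)%E) /\
    forall v, unit_sphere v ->
      exists2 u, u \in D & closed_halfspace v (dot v th) `<=` A u.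
Proof.
move=> e0.
have /choice[n hn] : forall u, exists n,
    unit_sphere u -> (F (cone u n) < (2^-1 + e)%:E)%E.
  move=> u; have [/unit_sphere_neq0 u0|?] := pselect (unit_sphere u).
    by have [n] := cone_lt u0 e0; exists n.
  by exists 0%N.
have := compact_unit_sphere; rewrite compact_cover.
(* The radius of the ball at [u] matches the slack of its cone, so [halfspace_cone] applies to every
   [v] in it. *)
move=> /(_ _ unit_sphere (fun u => interior (ball u (n u).+1%:R^-1))).
case=> [u _||D Ds Dcov].
- exact: open_interior.
- move=> u su; exists u => //; exact: nbhsx_ballx.
exists D, (fun u => cone u (n u)); split.
  by move=> u /Ds; rewrite inE => /hn; split => //; exact: measurable_cone.
move=> v /Dcov[u uD] /interior_subset [_ uv]; exists u => //.
by apply: halfspace_cone => j; exact/ltW/uv.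
Qed.

End sphere_cover.

(** Finitely many cones give finitely many almost sure eventual bounds, so a common threshold for
    [n] serves all halfspaces at [th]. The tolerances [k.+1%:R^-1] are countable, which puts them
    all under one null set. *)
Lemma uniform_halfspace_deviation {R : realType} {d : nat}
    (F : probability (borel_rV R d) R) (th : 'rV[R]_d)
    (disp : measure_display) (T : measurableType disp) (P : probability T R)
    (X : nat -> {RV P >-> borel_rV R d}) :
  iid F X -> halfspace_symmetric F th -> smooth_at F th ->
  {ae P, forall w, forall k : nat, \forall n \near \oo,
     forall u : 'rV[R]_d, u != 0 ->
       (halfspace_count (mkseq (fun i => X i w) n) u (dot u th))%:R <=
       n%:R * (2^-1 + k.+1%:R^-1) :> R}.
Proof.
move=> [indX XF] C2 C3; apply: ae_foralln => k.
have e0 : 0 < k.+1%:R^-1 :> R by rewrite invr_gt0.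
have [D [A [DA cov]]] := sphere_cover C2 C3 e0.
pose B u i : set T := X i @^-1` A u.
have ae_u u : u \in D -> {ae P, forall w, \forall n \near \oo,
    (hits (B u) n w)%:R <= n%:R * (2^-1 + k.+1%:R^-1) :> R}.
  move=> /DA[mA FA]; pose p := fine (F (A u)).
  have pE : F (A u) = p%:E by rewrite fineK// fin_num_measure.
  have mB i : measurable (B u i).
    by rewrite -[X in measurable X]setTI; exact: measurable_funP.
  apply: (@hits_deviation _ _ _ _ _ p) => //; last by rewrite -lte_fin -pE.
  move=> J; rewrite indX// (eq_bigr (fun=> p%:E)); last first.
    by move=> i _; rewrite -pE -(XF i).
  by rewrite prodEFin big_const_seq count_predT -Monoid.iteropE.
have : {ae P, forall w, (\bigcap_(u in [set` D])
    [set w | \forall n \near \oo,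
       (hits (B u) n w)%:R <= n%:R * (2^-1 + k.+1%:R^-1) :> R]) w}.
  by apply: filter_bigI => u /ae_u.
apply: filterS => w hw.
have : \forall n \near \oo, (\bigcap_(u in [set` D])
    [set n | (hits (B u) n w)%:R <= n%:R * (2^-1 + k.+1%:R^-1) :> R]) n.
  by apply: filter_bigI => u uD; exact: hw.
apply: filterS => n hn u u0.
rewrite -(halfspace_countZ _ u th (_ : 0 < (enorm u)^-1)) ?invr_gt0 ?enorm_gt0//.
have [v vD uA] := cov _ (unit_sphere_normalize u0).
apply: le_trans (hn v vD); rewrite ler_nat /halfspace_count /hits count_map.
by apply: sub_count => i /= Xi; rewrite inE; exact: uA.
Qed.

(** * Convergence of the breakdown point to 1/3 *)

Section breakdown_limit.
Context {R : realType} {d : nat}.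

(** For [q] the integer part of [n * (2^-1 + e)], [e <= 8^-1] gives [q < n], and [n * e >= 1]
    absorbs the rounding in [q.+1], which is at most [n * (2^-1 + 2 * e)]. The lower bound is then
    at least [3^-1 - e] and the upper one at most [3^-1 + e]. *)
Lemma addition_breakdown_near (s : seq 'rV[R]_d) th (e : R) : (2 <= d)%N ->
  0 < e -> e <= 8^-1 -> e^-1 <= (size s)%:R ->
  (forall u, u != 0 ->
    (halfspace_count s u (dot u th))%:R <= (size s)%:R * (2^-1 + e) :> R) ->
  addition_breakdown (@tukey_median R d) s \is a fin_num /\
  `|3^-1 - fine (addition_breakdown (@tukey_median R d) s)| <= e.
Proof.
move=> d2 e0 e8 es hs; set n := size s in es hs *.
have n0 : 0 < n%:R :> R by rewrite (lt_le_trans _ es)// invr_gt0.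
have ne : 1 <= n%:R * e by rewrite -ler_pdivrMr// mul1r.
have /truncn_itv : 0 <= n%:R * (2^-1 + e) by rewrite mulr_ge0// addr_ge0// ltW.
set q := Num.truncn _ => /andP[qle qlt].
have hq u : u != 0 -> (halfspace_count s u (dot u th) <= q)%N.
  by move=> /hs h; rewrite -ltnS -(ltr_nat R) (le_lt_trans h).
have qn : (q < n)%N by rewrite -(ltr_nat R) (le_lt_trans qle)//; nra.
have [lo hi] := addition_breakdown_bounds d2 hq qn.
set x := addition_breakdown _ _ in lo hi *.
have xfin : x \is a fin_num.
  by rewrite fin_numE -ltNye -ltey (lt_le_trans _ lo) ?(le_lt_trans hi) ?ltNyr ?ltry.
split => //; rewrite -(fineK xfin) !lee_fin in lo hi.
have lo' : 3^-1 - e <= fine x.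
  apply: le_trans lo; rewrite ler_pdivlMr ?ltr0n; last by lia.
  by rewrite natrD (natrB _ (ltnW qn)); nra.
have hi' : fine x <= 3^-1 + e.
  apply: (le_trans hi); rewrite ler_pdivrMr ?ltr0n; last by lia.
  by rewrite natrD -[q.+1]addn1 natrD; nra.
by rewrite ler_norml; lra.
Qed.

End breakdown_limit.

Theorem theorem1 (R : realType) (d : nat) (hd : (2 <= d)%N)
    (F : probability (borel_rV R d) R) (theta0 : 'rV[R]_d)
    (disp : measure_display) (T : measurableType disp) (P : probability T R)
    (X : nat -> {RV P >-> borel_rV R d})
    (hX : iid F X)
    (C1 : {ae P, forall w, \forall n \near \oo,
             full_affine_dim (mkseq (fun i => X i w) n)})
    (C2 : halfspace_symmetric F theta0)
    (C3 : smooth_at F theta0) :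
  {ae P, forall w,
    (fun n => addition_breakdown (@tukey_median R d)
                (mkseq (fun i => X i w) n)) @ \oo --> (3^-1)%:E}.
Proof.
have := uniform_halfspace_deviation hX C2 C3; apply: filterS => w hw.
(* The restriction on [k] makes the tolerance at most 1/8, as [addition_breakdown_near] requires. *)
have near_third k : (8 <= k.+1)%N -> \forall n \near \oo,
    addition_breakdown (@tukey_median R d) (mkseq (fun i => X i w) n) \is a fin_num /\
    `|3^-1 - fine (addition_breakdown (@tukey_median R d)
                     (mkseq (fun i => X i w) n))| <= k.+1%:R^-1.
  move=> k8; near=> n.
  apply: (addition_breakdown_near (th := theta0)) => //.
  - by rewrite lef_pV2 ?posrE// ler_nat.
  - by rewrite invrK size_mkseq ler_nat; near: n; exact: nbhs_infty_ge.
  - by rewrite size_mkseq; near: n; exact: hw.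
apply/fine_cvgP; split.
  by have := near_third 7 isT; apply: filterS => n [].
apply/cvgrPdist_le => e e0.
have [k ke] : exists k, k.+1%:R^-1 < e :> R.
  by have [k _ /(_ k (leqnn k))] := near_infty_natSinv_lt (PosNum e0); exists k.
have := near_third (maxn 7 k) (leq_maxl 7 k); apply: filterS => n [_ /le_trans]; apply.
by rewrite (le_trans _ (ltW ke))// lef_pV2 ?posrE// ler_nat ltnS leq_maxr.
Unshelve. all: by end_near. Qed.
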